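(* Consider the sixth Painlevé system $\frac{dx}{dt}=\frac{\partial H_{VI}}{\partial y}$, $\frac{dy}{dt}=-\frac{\partial H_{VI}}{\partial x}$ with $$H_{VI}=\frac{1}{t(t-1)}\Big[y^2(x-t)(x-1)x-\{(\alpha_0-1)(x-1)x+\alpha_3(x-t)x+\alpha_4(x-t)(x-1)\}y+\alpha_2(\alpha_1+\alpha_2)x\Big],$$ where $\alpha_0+\alpha_1+2\alpha_2+\alpha_3+\alpha_4=1$. Make the change of parameters and variables $$\alpha_0=\varepsilon^{-1},\quad \alpha_1=A_0,\quad \alpha_2=A_2,\quad \alpha_3=\frac{2A_3\varepsilon-1}{\varepsilon},\quad \alpha_4=A_1,$$ $$t=1-\varepsilon T,\quad x=\frac{1}{1-X},\quad y=X^2Y-2XY+A_2X+Y-A_2$$ from $\alpha_0,\dots,\alpha_4,t,x,y$ to $A_0,A_1,A_2,A_3,\varepsilon,T,X,Y$. Then the system can be written in the new variables $T,X,Y$ and parameters $A_0,A_1,A_2,A_3,\varepsilon$ as a Hamiltonian system, and as $\varepsilon\to0$ this new system tends to the system $$\frac{dX}{dT}=\frac{-2X^3Y+2X^2Y-(A_1+2A_2)X^2-(T-1+2A_3)X+T}{T},$$ $$\frac{dY}{dT}=\frac{3X^2Y^2-2XY^2+2(A_1+2A_2)XY+(T-1+2A_3)Y+(A_1+A_2)A_2}{T},$$ with $A_0+A_1+2A_2+2A_3=1$.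
   Context: A Hamiltonian system in $(X,Y)$ with independent variable $T$ is one of the form $dX/dT=\partial K/\partial Y$, $dY/dT=-\partial K/\partial X$ for a function $K(X,Y,T)$. ''Tends to'' means that the right-hand sides of the equations, as rational functions of $X,Y,T$ (with $A_i$ fixed), converge as $\varepsilon\to0$ to the right-hand sides of the limit system. *)

(* Defs.v *)
From HB Require Import structures.
From mathcomp Require Import all_boot all_order all_algebra generic_quotient ring.
From mathcomp Require Export fraction complex.
(* The notations of mpoly clash with those of mathcomp-analysis. *)
From mathcomp Require Export -(notations) mpoly.
From mathcomp Require Export all_classical all_reals all_analysis.

Set Implicit Arguments.
Unset Strict Implicit.
Unset Printing Implicit Defensive.

Import GRing.Theory Num.Theory.
Export numFieldNormedType.Exports.

Local Open Scope ring_scope.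
Local Open Scope classical_set_scope.
Local Open Scope quotient_scope.

(** Rational functions in three variables: the unknown q (x or X), its
    conjugate momentum p (y or Y), and the independent variable (t or T). *)

Notation poly3 C := (mpoly 3 C).
Notation ratfun C := {fraction mpoly 3 C}.

Definition iq : 'I_3 := @Ordinal 3 0 isT.
Definition ip : 'I_3 := @Ordinal 3 1 isT.
Definition it : 'I_3 := @Ordinal 3 2 isT.

Definition rvar (C : fieldType) (i : 'I_3) : ratfun C :=
  tofrac (mpolyX C (mnm1 i)).

Definition rcst (C : fieldType) (c : C) : ratfun C := tofrac (mpolyC 3 c).

(* Partial derivative by the quotient rule on a chosen representative;
   [rderivE] below shows that the choice is irrelevant. *)
Definition rderiv (C : fieldType) (i : 'I_3) (F : ratfun C) : ratfun C :=
  let n := (frac (repr F)).1 in let d := (frac (repr F)).2 in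
  tofrac (mderiv i n * d - n * mderiv i d) / tofrac (d ^+ 2).

Lemma frac_repr (R : idomainType) (F : {fraction R}) :
  F = tofrac (frac (repr F)).1 / tofrac (frac (repr F)).2.
Proof.
rewrite -{1}[F]reprK; case: (repr F) => -[n d] /= d0.
rewrite !piE /FracField.mulf /FracField.invf !numden_Ratio ?oner_eq0 //=.
rewrite mulr1 mul1r; congr (\pi_(_) _); apply/val_inj.
by rewrite /Ratio /insubd insubT.
Qed.

Lemma rderivE (C : fieldType) (i : 'I_3) (n d : poly3 C) : d != 0 ->
  rderiv i (tofrac n / tofrac d) =
  tofrac (mderiv i n * d - n * mderiv i d) / tofrac (d ^+ 2).
Proof.
move=> d0; rewrite /rderiv.
have := frac_repr (tofrac n / tofrac d).
have := denom_ratioP (repr (tofrac n / tofrac d)).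
case: (frac _) => r s /= s0 /eqP.
rewrite eqr_div ?tofrac_eq0 // -!tofracM tofrac_eq => /eqP E.
apply/eqP; rewrite eqr_div ?tofrac_eq0 ?expf_neq0 // -!tofracM tofrac_eq.
have E' := congr1 (mderiv i) E; rewrite !mderivM in E'.
have {}E' : mderiv i r * d = mderiv i n * s + n * mderiv i s - r * mderiv i d.
  by rewrite E' addrK.
apply/eqP; transitivity (s * d * (mderiv i r * d) - (r * d) * d * mderiv i s).
  by ring.
rewrite E' -E; transitivity
  (s * d * (mderiv i n * s + n * mderiv i s) - s * (r * d) * mderiv i d
   - n * s * d * mderiv i s); first by ring.
by rewrite -E; ring.
Qed.

Definition point3 (C : fieldType) (q p t : C) : 'I_3 -> C :=
  fun i => nth 0 [:: q; p; t] i.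

(* F is regular at v, with value w there. *)
Definition rvalue (C : fieldType) (F : ratfun C) (v : 'I_3 -> C) (w : C) :
    Prop :=
  exists n d : poly3 C,
    [/\ F = tofrac n / tofrac d, meval v d != 0 & w = meval v n / meval v d].

Lemma rvalue_unique (C : fieldType) (F : ratfun C) (v : 'I_3 -> C) (w w' : C) :
  rvalue F v w -> rvalue F v w' -> w = w'.
Proof.
move=> [n [d [-> d0 ->]]] [n' [d' [/eqP E d'0 ->]]].
have nz (f : poly3 C) : meval v f != 0 -> f != 0.
  by apply: contra_neq => ->; rewrite meval0.
move: E; rewrite eqr_div ?tofrac_eq0 ?nz // -!tofracM tofrac_eq => /eqP E.
by apply/eqP; rewrite eqr_div // -!mevalM E.
Qed.

(* (q, p) solves dq/dt = F(q,p,t), dp/dt = G(q,p,t) on D; over the complex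
   numbers [is_derive] is the complex derivative. *)
Definition solves (C : numFieldType) (F G : ratfun C) (D : set C)
    (q p : C -> C) : Prop :=
  forall t : C, D t -> exists a b : C,
    [/\ rvalue F (point3 (q t) (p t) t) a,
        rvalue G (point3 (q t) (p t) t) b,
        is_derive t 1 q a & is_derive t 1 p b].

(* Right-hand sides of the Hamiltonian system with Hamiltonian K. *)
Definition ham_q (C : fieldType) (K : ratfun C) : ratfun C := rderiv ip K.
Definition ham_p (C : fieldType) (K : ratfun C) : ratfun C := - rderiv iq K.

(* F e tends to G as e -> 0 (e != 0), as rational functions: numerators and
   denominators can be chosen of bounded degree, with coefficients converging
   to those of a numerator and a (nonzero) denominator of G. *)
Definition rcvg (C : numFieldType) (F : C -> ratfun C) (G : ratfun C) : Prop :=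
  exists (n d : C -> poly3 C) (n0 d0 : poly3 C) (N : nat),
    [/\ d0 != 0 /\ G = tofrac n0 / tofrac d0,
        \forall e \near 0^', F e = tofrac (n e) / tofrac (d e),
        \forall e \near 0^', (msize (n e) <= N)%N /\ (msize (d e) <= N)%N,
        forall m, mcoeff m (n e) @[e --> 0^'] --> (mcoeff m n0 : C) &
        forall m, mcoeff m (d e) @[e --> 0^'] --> (mcoeff m d0 : C)].

Definition H_VI (C : fieldType) (a0 a1 a2 a3 a4 : C) : ratfun C :=
  let x := rvar C iq in let y := rvar C ip in let t := rvar C it in
  (t * (t - 1))^-1 *
  (y ^+ 2 * (x - t) * (x - 1) * x
   - (rcst (a0 - 1) * (x - 1) * x + rcst a3 * (x - t) * x
      + rcst a4 * (x - t) * (x - 1)) * y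
   + rcst (a2 * (a1 + a2)) * x).

Definition limit_X (C : fieldType) (A1 A2 A3 : C) : ratfun C :=
  let X := rvar C iq in let Y := rvar C ip in let T := rvar C it in
  (- 2 * X ^+ 3 * Y + 2 * X ^+ 2 * Y - rcst (A1 + 2 * A2) * X ^+ 2
   - (T - 1 + rcst (2 * A3)) * X + T) / T.

Definition limit_Y (C : fieldType) (A1 A2 A3 : C) : ratfun C :=
  let X := rvar C iq in let Y := rvar C ip in let T := rvar C it in
  (3 * X ^+ 2 * Y ^+ 2 - 2 * X * Y ^+ 2 + 2 * rcst (A1 + 2 * A2) * X * Y
   + (T - 1 + rcst (2 * A3)) * Y + rcst ((A1 + A2) * A2)) / T.

Definition change_params (C : fieldType) (A0 A1 A2 A3 e : C)
    (a0 a1 a2 a3 a4 : C) : Prop :=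
  [/\ a0 = e^-1, a1 = A0, a2 = A2, a3 = (2 * A3 * e - 1) / e & a4 = A1].

(* The pairs (x, y), functions of t, and (X, Y), functions of T, correspond
   under t = 1 - e T, x = 1 / (1 - X), y = X^2 Y - 2 X Y + A2 X + Y - A2
   for T in D. *)
Definition change_vars (C : fieldType) (A2 e : C) (D : set C)
    (x y X Y : C -> C) : Prop :=
  forall T : C, D T ->
    [/\ X T != 1,
        x (1 - e * T) = 1 / (1 - X T) &
        y (1 - e * T) =
          X T ^+ 2 * Y T - 2 * X T * Y T + A2 * X T + Y T - A2].

(* Main.v *)
(** With u = 1 - X the substitution reads x = 1/u, y = u (u Y - A2), so that
    dx /\ dy = dX /\ dY for every T: it is canonical, and the transformed
    Hamiltonian is K = - e H_VI, up to terms in T alone.  The relation between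
    the parameters cancels the pole of K at X = 1, while the terms in 1/e cancel
    between alpha_0 and alpha_3, which leaves T (1 - e T) K polynomial in
    X, Y, T and affine in e. *)

Require Import Defs.
From mathcomp Require Import all_boot all_order all_algebra ring.

Set Implicit Arguments.
Unset Strict Implicit.
Unset Printing Implicit Defensive.

Import GRing.Theory Num.Theory.
Local Open Scope ring_scope.
Local Open Scope complex_scope.
Local Open Scope classical_set_scope.

(** * Derivatives and values of polynomials and of their quotients *)

Definition pvar (C : fieldType) (i : 'I_3) : poly3 C := mpolyX C (mnm1 i).

Lemma mderiv_pvar (C : fieldType) (i j : 'I_3) :
  mderiv i (pvar C j) = (i == j)%:R.
Proof.
rewrite mderivX mnm1E eq_sym; case: eqP => [->|_] /=; last by rewrite scale0r.
rewrite scale1r (_ : mnm_sub _ _ = mnm0) ?mpolyX0 //.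
by apply/mnmP => k; rewrite mnmBE mnm0E subnn.
Qed.

Definition mderivE := (mderiv_pvar, mderivC, mderivD, mderivB, mderivN, mderivM).
Definition mevalE := (mevalXU, mevalC, mevalD, mevalB, mevalN, mevalM, meval1).

Lemma meval_neq0 (C : fieldType) (v : 'I_3 -> C) (f : poly3 C) :
  meval v f != 0 -> f != 0.
Proof. by apply: contra_neq => ->; rewrite meval0. Qed.

(** The value enters through an equation, so that [field] can verify any closed form of the quotient
    rule at [v]. *)
Lemma rvalue_rderiv (C : fieldType) (i : 'I_3) (n d : poly3 C) (v : 'I_3 -> C)
    (w : C) :
  meval v d != 0 ->
  w = (meval v (mderiv i n) * meval v d - meval v n * meval v (mderiv i d))
      / meval v d ^+ 2 ->
  rvalue (rderiv i (tofrac n / tofrac d)) v w.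
Proof.
move=> d0 ->; exists (mderiv i n * d - n * mderiv i d), (d ^+ 2).
have dn0 := meval_neq0 d0.
split; rewrite ?rderivE // expr2 !mevalE //.
by rewrite mulf_neq0.
Qed.

Lemma rvalueN (C : fieldType) (F : ratfun C) (v : 'I_3 -> C) (w : C) :
  rvalue F v w -> rvalue (- F) v (- w).
Proof.
move=> [n [d [-> d0 ->]]]; exists (- n), d; split=> //.
  by rewrite tofracN mulNr.
by rewrite mevalN mulNr.
Qed.

(** * The two Hamiltonians and the values of their vector fields *)

Section Hamiltonian.
Variables (C : fieldType).
Let q := pvar C iq.
Let p := pvar C ip.
Let t := pvar C it.
Let c := mpolyC 3 (R := C).

Definition H_VI_num (a0 a1 a2 a3 a4 : C) : poly3 C :=
  p * p * (q - t) * (q - 1) * q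
   - (c (a0 - 1) * (q - 1) * q + c a3 * (q - t) * q
      + c a4 * (q - t) * (q - 1)) * p
   + c (a2 * (a1 + a2)) * q.

Lemma H_VIE (a0 a1 a2 a3 a4 : C) :
  H_VI a0 a1 a2 a3 a4 =
  tofrac (H_VI_num a0 a1 a2 a3 a4) / tofrac (t * (t - 1)).
Proof.
rewrite /H_VI /H_VI_num [RHS]mulrC /rvar /rcst /t /p /q /c.
by rewrite expr2 !(tofracD, tofracM, tofracN, tofrac1).
Qed.

Lemma rvalue_ham_q_H_VI (a0 a1 a2 a3 a4 x y s : C) : s != 0 -> s != 1 ->
  rvalue (ham_q (H_VI a0 a1 a2 a3 a4)) (point3 x y s)
    ((2 * y * (x - s) * (x - 1) * x
     - ((a0 - 1) * (x - 1) * x + a3 * (x - s) * x + a4 * (x - s) * (x - 1)))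
     / (s * (s - 1))).
Proof.
move=> s0 s1; have s1' : s - 1 != 0 by rewrite subr_eq0.
rewrite /ham_q H_VIE; apply: rvalue_rderiv.
  by rewrite !mevalE /point3 /= mulf_neq0.
(* The unit polynomial is turned into a constant [mpolyC], so that [mderivC] covers it. *)
rewrite /H_VI_num /q /p /t /c -mpolyC1 !mderivE !mevalE /point3 /=.
by field; rewrite s0 s1'.
Qed.

Lemma rvalue_ham_p_H_VI (a0 a1 a2 a3 a4 x y s : C) : s != 0 -> s != 1 ->
  rvalue (ham_p (H_VI a0 a1 a2 a3 a4)) (point3 x y s)
    (- (y ^+ 2 * ((x - 1) * x + (x - s) * x + (x - s) * (x - 1))
        - ((a0 - 1) * (2 * x - 1) + a3 * (2 * x - s)
           + a4 * (2 * x - s - 1)) * y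
        + a2 * (a1 + a2)) / (s * (s - 1))).
Proof.
move=> s0 s1; have s1' : s - 1 != 0 by rewrite subr_eq0.
rewrite /ham_p H_VIE mulNr; apply/rvalueN/rvalue_rderiv.
  by rewrite !mevalE /point3 /= mulf_neq0.
rewrite /H_VI_num /q /p /t /c -mpolyC1 !mderivE !mevalE /point3 /=.
by field; rewrite s0 s1'.
Qed.

(* [K0 + e K1] is the bracket of H_VI in the new variables, minus its terms
   free of X and Y. *)
Definition K0 (A1 A2 A3 : C) : poly3 C :=
  (1 - q) * (q * q) * (p * p) - c (A1 + 2 * A2) * (q * q) * p
  - (c (2 * A3) - 1) * q * p + t * (1 - q) * p - c ((A1 + A2) * A2) * q.

Definition K1 (A1 A2 A3 : C) : poly3 C :=
  t * ((1 - q) * p - c A2)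
    * (((1 - q) * p - c A2) * q - c (2 * A3) - c A1 * q).

(** With [t = 1 - e T] one has [- e / (t (t - 1)) = 1 / (T (1 - e T))], which is the prefactor of
    [- e H_VI]. *)
Definition Kden (e : C) : poly3 C := t * (1 - c e * t).

Definition K (A1 A2 A3 e : C) : ratfun C :=
  tofrac (K0 A1 A2 A3 + c e * K1 A1 A2 A3) / tofrac (Kden e).

Lemma Kden_neq0 (e : C) : Kden e != 0.
Proof.
(* Each factor has a point where it equals 1, whatever [e] is: the all-ones point for [t], the
   origin for [1 - e t]. *)
apply: mulf_neq0.
  by apply: (@meval_neq0 _ (fun=> 1)); rewrite mevalXU oner_neq0.
apply: (@meval_neq0 _ (fun=> 0)).
by rewrite !mevalE mulr0 subr0 oner_neq0.
Qed.

Lemma rvalue_ham_q_K (A1 A2 A3 e x y s : C) : s != 0 -> 1 - e * s != 0 ->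
  rvalue (ham_q (K A1 A2 A3 e)) (point3 x y s)
    ((2 * (1 - x) * x ^+ 2 * y - (A1 + 2 * A2) * x ^+ 2 - (2 * A3 - 1) * x
      + s * (1 - x)
      + e * s * (1 - x) * (2 * ((1 - x) * y - A2) * x - 2 * A3 - A1 * x))
     / (s * (1 - e * s))).
Proof.
move=> s0 s1; apply: rvalue_rderiv; first by rewrite !mevalE mulf_neq0.
rewrite /K0 /K1 /Kden /q /p /t /c -mpolyC1 !mderivE !mevalE /point3 /=.
by field; rewrite s0 s1.
Qed.

Lemma rvalue_ham_p_K (A1 A2 A3 e x y s : C) : s != 0 -> 1 - e * s != 0 ->
  rvalue (ham_p (K A1 A2 A3 e)) (point3 x y s)
    ((3 * x ^+ 2 * y ^+ 2 - 2 * x * y ^+ 2 + 2 * (A1 + 2 * A2) * x * y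
      + (s - 1 + 2 * A3) * y + (A1 + A2) * A2
      + e * s * (y * (((1 - x) * y - A2) * x - 2 * A3 - A1 * x)
                 - ((1 - x) * y - A2) * ((1 - x) * y - A2 - x * y - A1)))
     / (s * (1 - e * s))).
Proof.
move=> s0 s1; rewrite -[X in rvalue _ _ X]opprK.
apply/rvalueN/rvalue_rderiv; first by rewrite !mevalE mulf_neq0.
rewrite /K0 /K1 /Kden /q /p /t /c -mpolyC1 !mderivE !mevalE /point3 /=.
by field; rewrite s0 s1.
Qed.

(** Applied to [Kden], which involves only [T]: the vector field keeps the denominator of [K]
    instead of its square, and so remains a quotient of polynomials affine in [e]. *)
Lemma rderiv_frac_const (i : 'I_3) (n d : poly3 C) : d != 0 ->
  mderiv i d = 0 ->
  rderiv i (tofrac n / tofrac d) = tofrac (mderiv i n) / tofrac d.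
Proof.
move=> d0 dd; rewrite rderivE // dd mulr0 subr0 expr2 !tofracM.
by rewrite -mulf_div divff ?tofrac_eq0 // mulr1.
Qed.
End Hamiltonian.

(** * The limit as [e] tends to 0 *)

(** The sizes are bounded independently of [e], and each coefficient is an affine function of [e],
    hence tends to its value at 0. *)
Lemma rcvg_affine (C : numFieldType) (F : C -> ratfun C) (n0 n1 d0 d1 : poly3 C) :
  d0 != 0 ->
  (forall e, F e = tofrac (n0 + mpolyC 3 e * n1) / tofrac (d0 + mpolyC 3 e * d1)) ->
  rcvg F (tofrac n0 / tofrac d0).
Proof.
move=> d0_neq0 FE.
have size_affine (f g : poly3 C) (e : C) :
    (msize (f + mpolyC 3 e * g) <= maxn (msize f) (msize g))%N.
  rewrite mul_mpolyC (leq_trans (msizeD_le _ _)) // geq_max leq_maxl /=.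
  by rewrite (leq_trans (msizeZ_le _ _)) ?leq_maxr.
have cvg_affine (f g : poly3 C) m :
    mcoeff m (f + mpolyC 3 e * g) @[e --> 0^'] --> (mcoeff m f : C).
  have -> : (fun e : C => mcoeff m (f + mpolyC 3 e * g)) =
            (fun e => mcoeff m f + e * mcoeff m g).
    by apply/funext => e; rewrite mcoeffD mcoeffCM.
  have fE : mcoeff m f = mcoeff m f + 0 * mcoeff m g by rewrite mul0r addr0.
  rewrite [X in _ --> X]fE.
  apply: cvgD; first exact: cvg_cst.
  apply: cvgM; last exact: cvg_cst.
  exact: nbhs_dnbhs.
exists (fun e => n0 + mpolyC 3 e * n1), (fun e => d0 + mpolyC 3 e * d1), n0, d0,
  (maxn (maxn (msize n0) (msize n1)) (maxn (msize d0) (msize d1))).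
split=> //; near=> e; first exact: FE.
by split; apply: leq_trans (size_affine _ _ _) _; rewrite ?leq_maxl ?leq_maxr.
Unshelve. all: by end_near.
Qed.

Section Limits.
Variables (C : numFieldType) (A1 A2 A3 : C).

Let KdenE (e : C) : Kden e = pvar C it + mpolyC 3 e * - (pvar C it * pvar C it).
Proof. by rewrite /Kden; ring. Qed.

(** The limit system is itself Hamiltonian, with Hamiltonian [K0 / T], the value of [K] at
    [e = 0]. *)
Lemma rcvg_ham_q_K : rcvg (fun e => ham_q (K A1 A2 A3 e)) (limit_X A1 A2 A3).
Proof.
have -> : limit_X A1 A2 A3 = tofrac (mderiv ip (K0 A1 A2 A3)) / tofrac (pvar C it).
  congr (_ / _).
  rewrite /K0 -mpolyC1 !mderivE /= mpolyC1.
  rewrite !(tofracD, tofracM, tofracN, tofrac1, tofrac0).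
  by rewrite /rvar /rcst /pvar; ring.
apply: (@rcvg_affine _ _ _ (mderiv ip (K1 A1 A2 A3)) _
   (- (pvar C it * pvar C it))) => [|e].
  (* At [e = 0] the denominator [Kden] reduces to [T]. *)
  by have := Kden_neq0 (0 : C); rewrite KdenE mpolyC0 mul0r addr0.
rewrite /ham_q /K rderiv_frac_const ?Kden_neq0 // -?KdenE.
  by rewrite mderivD mderivM mderivC mul0r add0r.
by rewrite /Kden -mpolyC1 !mderivE /= !(mul0r, mulr0, subr0, addr0).
Qed.

Lemma rcvg_ham_p_K : rcvg (fun e => ham_p (K A1 A2 A3 e)) (limit_Y A1 A2 A3).
Proof.
have -> : limit_Y A1 A2 A3 = tofrac (- mderiv iq (K0 A1 A2 A3)) / tofrac (pvar C it).
  congr (_ / _).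
  rewrite /K0 -mpolyC1 !mderivE /= mpolyC1.
  rewrite !(tofracD, tofracM, tofracN, tofrac1, tofrac0).
  by rewrite /rvar /rcst /pvar; ring.
apply: (@rcvg_affine _ _ _ (- mderiv iq (K1 A1 A2 A3)) _
   (- (pvar C it * pvar C it))) => [|e].
  by have := Kden_neq0 (0 : C); rewrite KdenE mpolyC0 mul0r addr0.
rewrite /ham_p /K rderiv_frac_const ?Kden_neq0 // -?KdenE.
  by rewrite mderivD mderivM mderivC mul0r add0r mulrN -opprD tofracN mulNr.
by rewrite /Kden -mpolyC1 !mderivE /= !(mul0r, mulr0, subr0, addr0).
Qed.
End Limits.

(** * Derivatives under the change of variables *)

(** Values of rational functions are unique, so the existential values in [solves] can be replaced
    by known closed forms. *)
Lemma solvesP (C : numFieldType) (F G : ratfun C) (D : set C) (q p f g : C -> C) :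
  (forall t, D t -> rvalue F (point3 (q t) (p t) t) (f t)) ->
  (forall t, D t -> rvalue G (point3 (q t) (p t) t) (g t)) ->
  solves F G D q p <->
  (forall t, D t -> is_derive t 1 q (f t) /\ is_derive t 1 p (g t)).
Proof.
move=> Ff Gg; split=> sol t Dt.
  have [a [b [Fa Gb qa pb]]] := sol t Dt.
  by rewrite (rvalue_unique (Ff t Dt) Fa) (rvalue_unique (Gg t Dt) Gb).
by have [qf pg] := sol t Dt; exists (f t), (g t); split; auto.
Qed.

Lemma is_derive_inv (C : numFieldType) (f : C -> C) (t df : C) :
  f t != 0 -> is_derive t 1 f df ->
  is_derive t 1 (fun s => (f s)^-1) (- df / f t ^+ 2).
Proof.
move=> ft0 fdf; have [fd fE] := fdf; apply: DeriveDef; first exact: derivableV.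
by rewrite deriveV // fE scaleNr mulNr [df / _]mulrC.
Qed.

Lemma is_derive_affine (C : numFieldType) (a b : C) (f : C -> C) (t df : C) :
  is_derive (b + a * t) 1 f df ->
  is_derive t 1 (fun s => f (b + a * s)) (a * df).
Proof.
move=> [fd fE].
have gE : is_derive t 1 (fun s => b + a * s) a.
  have := is_deriveD (is_derive_cst b t (1 : C)) (is_deriveZ a (is_derive_id t (1 : C))).
  by rewrite add0r scaler1.
have [gd gE'] := gE.
apply: DeriveDef.
  (* In one variable derivability is differentiability, so the chain rule for differentials
     applies. *)
  by apply/derivable1_diffP/differentiable_comp; exact/derivable1_diffP.
move: fd gd => /derivable1_diffP fd /derivable1_diffP gd.
rewrite deriveE; last exact: differentiable_comp.
by rewrite diff_comp //= !diff1E // !derive1E fE gE' scale1r.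
Qed.

Lemma is_derive_affineE (C : numFieldType) (a b : C) (f : C -> C) (t df : C) :
  a != 0 ->
  is_derive (b + a * t) 1 f df <->
  is_derive t 1 (fun s => f (b + a * s)) (a * df).
Proof.
move=> a0; split; first exact: is_derive_affine.
(* The converse is the same chain rule for the inverse affine map [s |-> (s - b) / a]. *)
have tE : t = - (b / a) + a^-1 * (b + a * t) by field.
rewrite {1}tE => /is_derive_affine; rewrite mulKf //.
congr (is_derive _ _ _ _).
by apply/funext => s; congr f; field.
Qed.

(* The converse direction uses the inverse substitution X = 1 - 1/x,
   Y = x^2 y + A2 x. *)
Lemma is_derive_change_vars (C : numFieldType) (A2 e : C) (D : set C)
    (x y X Y : C -> C) (T f g F G : C) :
  e != 0 -> open D -> D T -> change_vars A2 e D x y X Y ->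
  - e * f = F / (1 - X T) ^+ 2 ->
  - e * g = (1 - X T) ^+ 2 * G - 2 * (1 - X T) * Y T * F + A2 * F ->
  is_derive (1 - e * T) 1 x f /\ is_derive (1 - e * T) 1 y g <->
  is_derive T 1 X F /\ is_derive T 1 Y G.
Proof.
move=> e0 Dopen DT xyXY fF gG.
(* The substitution is known only on [D]; openness makes its identities hold near [T], as
   differentiation there requires. *)
have nearD : \near T, D T by exact: open_nbhs_nbhs.
have [X1 xT yT] := xyXY T DT.
have X1' : 1 - X T != 0 by rewrite subr_eq0 eq_sym.
set xi := fun s => x (1 + - e * s); set eta := fun s => y (1 + - e * s).
have xiE : \near T, xi T = (1 - X T)^-1.
  apply: filterS nearD => s Ds; have [_ xs _] := xyXY s Ds.
  by rewrite /xi mulNr xs div1r.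
have etaE : \near T, eta T = (1 - X T) ^+ 2 * Y T - A2 * (1 - X T).
  apply: filterS nearD => s Ds; have [_ _ ys] := xyXY s Ds.
  by rewrite /eta mulNr ys; ring.
have nearX1 : \near T, 1 - X T != 0.
  apply: filterS nearD => s Ds; have [Xs _ _] := xyXY s Ds.
  by rewrite subr_eq0 eq_sym.
have en0 : - e != 0 by rewrite oppr_eq0.
(* The derivatives of [xi] and [eta] at [T] are [- e f] and [- e g], which the hypotheses express
   through [F] and [G]. *)
rewrite -mulNr (is_derive_affineE _ _ _ _ en0) (is_derive_affineE _ _ _ _ en0).
rewrite fF gG -/xi -/eta; have xiT := nbhs_singleton xiE.
have etaT := nbhs_singleton etaE.
split=> -[d1 d2].
  have xi0 : xi T != 0 by rewrite xiT invr_eq0.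
  have d3 := is_derive_inv xi0 d1.
  split.
    (* Near [T] the function is replaced by an expression built from operations on functions, whose
       derivative is found by instance inference. *)
    apply: (@near_eq_is_derive _ _ _ (cst 1 - (fun s => (xi s)^-1))).
      by apply: filterS xiE => s xis; rewrite !fctE xis invrK subKr.
    by apply: is_derive_eq; rewrite xiT; field.
  apply: (@near_eq_is_derive _ _ _ (xi ^+ 2 * eta + A2 \*: xi)).
    move: nearX1 xiE etaE; apply: filterS3 => s s0 xis etas.
    by rewrite !fctE /= xis etas /GRing.scale /=; field; exact: s0.
  by apply: is_derive_eq; rewrite !fctE xiT etaT /GRing.scale /=; field.
have d3 : is_derive T 1 (fun s => 1 - X s) (- F).
  by have := is_deriveB (is_derive_cst (1 : C) T (1 : C)) d1; rewrite sub0r.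
have d4 := @is_derive_inv _ (fun s => 1 - X s) _ _ X1' d3.
split.
  apply: (@near_eq_is_derive _ _ _ (fun s => (1 - X s)^-1)).
    by apply: filterS xiE => s ->.
  by apply: is_derive_eq; rewrite opprK.
apply: (@near_eq_is_derive _ _ _
    ((fun s => 1 - X s) ^+ 2 * Y - A2 \*: (fun s => 1 - X s))).
  by apply: filterS etaE => s ->.
by apply: is_derive_eq; rewrite !fctE /GRing.scale /=; ring.
Qed.

(** * Equivalence of the two Hamiltonian systems *)

Lemma forall_image_iff (S T : Type) (f : S -> T) (D : set S) (P : T -> Prop)
    (Q : S -> Prop) :
  (forall a, D a -> P (f a) <-> Q a) ->
  (forall b, (f @` D) b -> P b) <-> (forall a, D a -> Q a).
Proof.
move=> PQ; split=> [Pf a Da|Qf _ [a Da <-]]; last exact/PQ/Qf.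
by apply/PQ => //; apply: Pf; exists a.
Qed.

(** The term [1 / e] of [alpha_0] cancels the [- 1 / e] contained in [alpha_3]. *)
Lemma change_params_sum (C : fieldType) (A0 A1 A2 A3 e : C) : e != 0 ->
  e^-1 + A0 + 2 * A2 + (2 * A3 * e - 1) / e + A1 = A0 + A1 + 2 * A2 + 2 * A3.
Proof. by move=> e0; field. Qed.

(** Away from [t = 0] and [t = 1] both vector fields have explicit values, so the equivalence
    reduces, point by point, to two rational identities between them. *)
Lemma solves_change_vars (C : numFieldType) (A0 A1 A2 A3 e a0 a1 a2 a3 a4 : C)
    (D : set C) (x y X Y : C -> C) :
  A0 + A1 + 2 * A2 + 2 * A3 = 1 -> e != 0 ->
  change_params A0 A1 A2 A3 e a0 a1 a2 a3 a4 ->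
  open D -> (forall T, D T -> 1 - e * T != 0 /\ 1 - e * T != 1) ->
  change_vars A2 e D x y X Y ->
  solves (ham_q (H_VI a0 a1 a2 a3 a4)) (ham_p (H_VI a0 a1 a2 a3 a4))
    [set 1 - e * T | T in D] x y <->
  solves (ham_q (K A1 A2 A3 e)) (ham_p (K A1 A2 A3 e)) D X Y.
Proof.
move=> A_sum e0 [-> -> -> -> ->] Dopen t01 xyXY.
have T01 T : D T -> T != 0 /\ 1 - e * T != 0.
  move=> /t01[t0 t1]; split=> //; apply: contra_neq t1 => ->.
  by rewrite mulr0 subr0.
have im01 t : [set 1 - e * T | T in D] t -> t != 0 /\ t != 1.
  by move=> [T DT <-]; exact: t01.
apply: iff_trans.
  (* The placeholders are filled by unification with the closed forms of the [rvalue] lemmas. *)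
  apply: (@solvesP _ _ _ _ _ _ (fun t => _) (fun t => _)) => t /im01[t0 t1].
    exact: rvalue_ham_q_H_VI.
  exact: rvalue_ham_p_H_VI.
apply: iff_sym; apply: iff_trans.
  apply: (@solvesP _ _ _ _ _ _ (fun t => _) (fun t => _)) => t /T01[t0 t1].
    exact: rvalue_ham_q_K.
  exact: rvalue_ham_p_K.
(* The parameter relation is solved for [A0], which enters through [alpha_2 (alpha_1 + alpha_2)] in
   the equation for [y]. *)
have : A0 = A0 + A1 + 2 * A2 + 2 * A3 - A1 - 2 * A2 - 2 * A3 by ring.
rewrite A_sum => A0E.
apply: iff_sym; apply: forall_image_iff => T DT.
have [T0 t0] := T01 T DT; have [X1 xT yT] := xyXY T DT.
have X1' : 1 - X T != 0 by rewrite subr_eq0 eq_sym.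
have t1' : 1 - e * T - 1 != 0 by rewrite subr_eq0; have [] := t01 T DT.
(* The two remaining goals say that the substitution carries one vector field to the other. *)
apply: (is_derive_change_vars e0 Dopen DT xyXY); rewrite xT yT.
  by field; rewrite X1' e0 T0 t0 t1'.
by rewrite A0E; field; rewrite X1' e0 T0 t0 t1'.
Qed.

Theorem theorem1p3 (R : realType) (A0 A1 A2 A3 : R[i]) :
  (forall e a0 a1 a2 a3 a4 : R[i], e != 0 ->
     change_params A0 A1 A2 A3 e a0 a1 a2 a3 a4 ->
     (a0 + a1 + 2 * a2 + a3 + a4 = 1 <-> A0 + A1 + 2 * A2 + 2 * A3 = 1)) /\
  (A0 + A1 + 2 * A2 + 2 * A3 = 1 ->
   exists K : R[i] -> ratfun R[i],
     [/\ forall e a0 a1 a2 a3 a4 : R[i], e != 0 ->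
           change_params A0 A1 A2 A3 e a0 a1 a2 a3 a4 ->
           forall (D : set (R[i] : numFieldType))
                  (x y X Y : R[i] -> R[i]),
             open D ->
             (forall T, D T -> 1 - e * T != 0 /\ 1 - e * T != 1) ->
             change_vars A2 e D x y X Y ->
             (solves (ham_q (H_VI a0 a1 a2 a3 a4)) (ham_p (H_VI a0 a1 a2 a3 a4))
                [set 1 - e * T | T in D] x y <->
              solves (ham_q (K e)) (ham_p (K e)) D X Y),
         rcvg (fun e => ham_q (K e)) (limit_X A1 A2 A3) &
         rcvg (fun e => ham_p (K e)) (limit_Y A1 A2 A3)]).
Proof.
split=> [e a0 a1 a2 a3 a4 e0 [-> -> -> -> ->]|A_sum].
  by rewrite change_params_sum.
exists (K A1 A2 A3); split; last 2 first.
- exact: rcvg_ham_q_K.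
- exact: rcvg_ham_p_K.
move=> e a0 a1 a2 a3 a4 e0 params D x y X Y.
exact: (solves_change_vars A_sum e0 params).
Qed.
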